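(* Let $K,K':\mathbb B_d\times\mathbb B_d\to\mathcal M_d(\mathbb C)$ be two non-negative definite kernels, either both of the form (♯) $\sum_{\ell\ge1}(a_{\ell,1}-a_{\ell,2})\langle\boldsymbol z,\boldsymbol w\rangle^{\ell-1}\bar{\boldsymbol w}\boldsymbol z^\dagger+\sum_{\ell\ge0}a_{\ell,2}\langle\boldsymbol z,\boldsymbol w\rangle^\ell I_d$ (with their own coefficients), or both of the form (♯♯) $\sum_{\ell\ge1}(\tilde a_{\ell,1}-\tilde a_{\ell,2})\langle\boldsymbol z,\boldsymbol w\rangle^{\ell-1}\boldsymbol z\bar{\boldsymbol w}^\dagger+\sum_{\ell\ge0}\tilde a_{\ell,2}\langle\boldsymbol z,\boldsymbol w\rangle^\ell I_d$ (with their own coefficients). Assume that the $d$-tuples $\boldsymbol M$ of multiplication by the coordinate functions on $\mathcal H_K(\mathbb B_d,\mathbb C^d)$ and on $\mathcal H_{K'}(\mathbb B_d,\mathbb C^d)$ are bounded. Then these two $d$-tuples are unitarily equivalent if and only if $K=K'$.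
   Context: $\mathbb B_d$ is the unit ball of $\mathbb C^d$, $\langle\boldsymbol z,\boldsymbol w\rangle=\sum_iz_i\bar w_i$; $\bar{\boldsymbol w}\boldsymbol z^\dagger$ is the matrix with $(i,j)$ entry $\bar w_iz_j$ and $\boldsymbol z\bar{\boldsymbol w}^\dagger$ the matrix with $(i,j)$ entry $z_i\bar w_j$; the coefficients are complex numbers.
   Formalization: Both kernels are assumed normalized, K(z,0)=K'(z,0)=I_d (a_{0,2}=1); otherwise the claim fails: K=I_d/(1-⟨z,w⟩) and K'=2K have unitarily equivalent tuples via f↦√2 f. A common value a_{0,2}=c>0 reduces to this by scaling. *)

(* Defs.v *)
From HB Require Import structures.
From mathcomp Require Import all_boot all_order all_algebra.
From mathcomp Require Import complex.
From mathcomp Require Import reals.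
Set Implicit Arguments. Unset Strict Implicit. Unset Printing Implicit Defensive.
Import Order.TTheory GRing.Theory Num.Theory.
Local Open Scope ring_scope.

(* Complex numbers: C = R[i] for a real type R (complete archimedean field). *)
Section Defs.
Variable R : realType.
Local Notation C := (R[i]).
Variable d : nat.

(* <z, w> = sum_i z_i * conj(w_i) *)
Definition cinner (z w : 'cV[C]_d) : C := \sum_(i < d) z i 0 * (w i 0)^*.

(* the open unit ball B_d of C^d, as a subtype *)
Definition in_ball (z : 'cV[C]_d) : bool := cinner z z < 1.
Definition Ball := {z : 'cV[C]_d | in_ball z}.

Lemma in_ball0 : in_ball 0.
Proof. by rewrite /in_ball /cinner big1 ?ltr01 // => i _; rewrite mxE mul0r. Qed.
Definition ball0 : Ball := exist _ 0 in_ball0.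

(* conj(w) z^dagger : (i,j) entry  conj(w_i) z_j  (as fixed in the context) *)
Definition wbar_zdag (z w : 'cV[C]_d) : 'M[C]_d := \matrix_(i, j) ((w i 0)^* * z j 0).
(* z conj(w)^dagger : (i,j) entry  z_i conj(w_j) *)
Definition z_wbardag (z w : 'cV[C]_d) : 'M[C]_d := \matrix_(i, j) (z i 0 * (w j 0)^*).

(* entrywise convergence of a sequence of matrices *)
Definition mx_cvg (S : nat -> 'M[C]_d) (L : 'M[C]_d) : Prop :=
  forall i j (eps : C), 0 < eps ->
    exists N : nat, forall n, (N <= n)%N -> `|S n i j - L i j| < eps.

(* kernel of form (#): P z w is w̄z^† for (#), z w̄^† for (##) *)
Definition kernel_form (P : 'cV[C]_d -> 'cV[C]_d -> 'M[C]_d)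
    (K : Ball -> Ball -> 'M[C]_d) (a1 a2 : nat -> C) : Prop :=
  forall z w : Ball,
    exists X Y : 'M[C]_d,
      mx_cvg (fun n => \sum_(1 <= l < n.+1)
                 ((a1 l - a2 l) * cinner (val z) (val w) ^+ l.-1) *: P (val z) (val w)) X
   /\ mx_cvg (fun n => \sum_(0 <= l < n.+1)
                 (a2 l * cinner (val z) (val w) ^+ l) *: (1%:M : 'M[C]_d)) Y
   /\ K z w = X + Y.

Definition form_sharp K a1 a2 := kernel_form wbar_zdag K a1 a2.
Definition form_sharpsharp K a1 a2 := kernel_form z_wbardag K a1 a2.

(* non-negative definite matrix-valued kernel *)
Definition nnd_kernel (K : Ball -> Ball -> 'M[C]_d) : Prop :=
  forall (n : nat) (w : 'I_n -> Ball) (v : 'I_n -> 'cV[C]_d),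
    0 <= \sum_(i < n) \sum_(j < n) cinner (K (w i) (w j) *m v j) (v i).

(* normalized at the origin: K(z,0) = I *)
Definition normalized_kernel (K : Ball -> Ball -> 'M[C]_d) : Prop :=
  forall z, K z ball0 = 1%:M.

(* functions B_d -> C^d *)
Definition fn := Ball -> 'cV[C]_d.

(* K(., w) v *)
Definition kfun (K : Ball -> Ball -> 'M[C]_d) (w : Ball) (v : 'cV[C]_d) : fn :=
  fun z => K z w *m v.

(* multiplication by the i-th coordinate function *)
Definition mult_coord (i : 'I_d) (f : fn) : fn := fun z => (val z) i 0 *: f z.

(* A reproducing kernel Hilbert space H_K(B_d, C^d) with kernel K:
   a linear space of functions with a complete inner product, containing
   the K(., w) v and with the reproducing property <f, K(.,w)v> = <f(w), v>. *)
Record RKHS (K : Ball -> Ball -> 'M[C]_d) := {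
  mem : fn -> Prop;
  ip : fn -> fn -> C;
  mem0 : mem (fun _ => 0);
  memDZ : forall (a : C) f g, mem f -> mem g -> mem (fun z => a *: f z + g z);
  ipDZ : forall (a : C) f g h, mem f -> mem g -> mem h ->
           ip (fun z => a *: f z + g z) h = a * ip f h + ip g h;
  ip_conj : forall f g, mem f -> mem g -> ip g f = (ip f g)^*;
  ip_ge0 : forall f, mem f -> 0 <= ip f f;
  ip_eq0 : forall f, mem f -> ip f f = 0 -> f = (fun _ => 0);
  complete : forall u : nat -> fn, (forall n, mem (u n)) ->
    (forall eps : C, 0 < eps -> exists N : nat, forall m n, (N <= m)%N -> (N <= n)%N ->
         sqrtC (ip (fun z => u m z - u n z) (fun z => u m z - u n z)) < eps) ->
    exists f, mem f /\
    (forall eps : C, 0 < eps -> exists N : nat, forall n, (N <= n)%N ->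
         sqrtC (ip (fun z => u n z - f z) (fun z => u n z - f z)) < eps);
  mem_kfun : forall w v, mem (kfun K w v);
  reproducing : forall f w v, mem f -> ip f (kfun K w v) = cinner (f w) v
}.

Definition hnorm K (H : RKHS K) (f : fn) : C := sqrtC (ip H f f).

(* the d-tuple M of coordinate multiplications is bounded on H *)
Definition bounded_mult K (H : RKHS K) : Prop :=
  forall i : 'I_d,
    (forall f, mem H f -> mem H (mult_coord i f)) /\
    exists c : C, 0 <= c /\
      forall f, mem H f -> hnorm H (mult_coord i f) <= c * hnorm H f.

(* unitary equivalence of the tuples M on H and on H' *)
Definition unitarily_equivalent K K' (H : RKHS K) (H' : RKHS K') : Prop :=
  exists U : fn -> fn,
    [/\ forall f, mem H f -> mem H' (U f),
        forall (a : C) f g, mem H f -> mem H g ->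
          U (fun z => a *: f z + g z) = (fun z => a *: U f z + U g z),
        forall f g, mem H f -> mem H g -> ip H' (U f) (U g) = ip H f g,
        forall g, mem H' g -> exists2 f, mem H f & U f = g
      & forall i f, mem H f -> U (mult_coord i f) = mult_coord i (U f)].

End Defs.

(* Main.v *)
(* Every homogeneous component k_l of the kernel is the limit of averages of
   K(z, omega w) over roots of unity omega, each a function of norm at most
   that of K(., w)v; since the norm is lower semicontinuous under bounded
   pointwise convergence, |k_l(., w)v| <= |K(., w)v|, so the expansion of K(.,
   rw)v converges in norm for r < 1 and the polynomials (which lie in H because
   M is bounded and K is normalized) are dense. Hence the joint kernel of the
   adjoints of M consists of the constants, a unitary intertwiner acts on
   constants by a unitary matrix A, and K' = A K A^*; averaging again gives the
   same identity between homogeneous components. Evaluating those at a multiple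
   of an eigenvector of A, where the rank one part commutes with A, makes the
   coefficients agree when d >= 2; for d = 1 the matrices are scalars.
   Conversely, a kernel determines its Hilbert space, so the identity is
   unitary. *)
Require Import Defs.
From HB Require Import structures.
From mathcomp Require Import all_boot all_order all_algebra.
From mathcomp Require Import separable cyclotomic cyclic spectral.
From mathcomp Require Import complex.
From mathcomp Require Import boolp classical_sets functions reals.
From mathcomp Require Import sequences topology normedtype.
From mathcomp Require Import ring lra zify.
Import Order.TTheory GRing.Theory Num.Theory.
Import numFieldNormedType.Exports.
Local Open Scope ring_scope.
Local Open Scope classical_set_scope.
Set Implicit Arguments. Unset Strict Implicit. Unset Printing Implicit Defensive.
Import Normc.
Local Notation "x %:C" := (real_complex _ x) : ring_scope.
Local Notation Re := complex.Re.

(** * Scalar limits *)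

Section Modulus.
Variable R : realType.
Local Notation C := R[i].
Implicit Types (x y l m : C) (u : nat -> C) (e r c : R).

Lemma norm_normcE x : `|x| = (normc x)%:C. Proof. by []. Qed.

Lemma normc_ge0 x : 0 <= normc x.
Proof. by rewrite -ler0c -norm_normcE. Qed.

Lemma normcD x y : normc (x + y) <= normc x + normc y.
Proof. by rewrite -lecR rmorphD /= -!norm_normcE ler_normD. Qed.

Lemma normcN x : normc (- x) = normc x.
Proof. by apply: complexI; rewrite -!norm_normcE normrN. Qed.

Lemma normcB x y : normc (x - y) = normc (y - x).
Proof. by rewrite -normcN opprB. Qed.

Lemma normcX x n : normc (x ^+ n) = normc x ^+ n.
Proof. by apply: complexI; rewrite rmorphXn /= -!norm_normcE normrX. Qed.

Lemma normc_conj x : normc x^* = normc x.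
Proof. by apply: complexI; rewrite -!norm_normcE norm_conjC. Qed.

Lemma normc_real r : 0 <= r -> normc r%:C = r.
Proof. by move=> r0; apply: complexI; rewrite -!norm_normcE ger0_norm // ler0c. Qed.

Lemma normc_sum (I : Type) (s : seq I) (P : pred I) (F : I -> C) :
  normc (\sum_(i <- s | P i) F i) <= \sum_(i <- s | P i) normc (F i).
Proof.
rewrite -lecR rmorph_sum /= -norm_normcE; exact: ler_norm_sum.
Qed.

Lemma normc0_eq0 x : normc x <= 0 -> x = 0.
Proof. by move=> h; apply: eq0_normc; apply/eqP; rewrite eq_le h normc_ge0. Qed.

Lemma mul_conj x : x * x^* = ((normc x) ^+ 2)%:C.
Proof. by rewrite -normCK norm_normcE rmorphXn. Qed.

Lemma conj_real r : (r%:C)^* = r%:C.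
Proof. by apply: conj_Creal; rewrite complex_real eqxx. Qed.

(** The modulus is the real number [normc], so estimates on limits are inequalities in [R], within
    reach of [lra] and [nra]. *)
Definition tends u l := forall e, 0 < e -> exists N, forall n, (N <= n)%N -> normc (u n - l) < e.

Lemma tends_cst l : tends (fun=> l) l.
Proof. by move=> e e0; exists 0%N => n _; rewrite subrr normc0. Qed.

Lemma tendsD u v l m : tends u l -> tends v m -> tends (fun n => u n + v n) (l + m).
Proof.
move=> ul vm e e0; have e2 : 0 < e / 2 by rewrite divr_gt0.
have [N hN] := ul _ e2; have [M hM] := vm _ e2.
exists (maxn N M) => n; rewrite geq_max => /andP[/hN h1 /hM h2].
rewrite opprD addrACA; apply: le_lt_trans (normcD _ _) _; lra.
Qed.

Lemma tendsZ x u l : tends u l -> tends (fun n => x * u n) (x * l).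
Proof.
move=> ul e e0; have p : 0 < normc x + 1 by have := normc_ge0 x; lra.
have [|N hN] := ul (e / (normc x + 1)); first by rewrite divr_gt0.
exists N => n /hN h; rewrite -mulrBr normcM.
rewrite ltr_pdivlMr // in h; apply: le_lt_trans h.
by rewrite mulrC ler_wpM2l ?normc_ge0 ?lerDl.
Qed.

Lemma tends_sum (I : Type) (s : seq I) (F : I -> nat -> C) (L : I -> C) :
  (forall i, tends (F i) (L i)) ->
  tends (fun n => \sum_(i <- s) F i n) (\sum_(i <- s) L i).
Proof.
move=> h; elim: s => [|i s IH].
  rewrite big_nil (_ : (fun _ => _) = fun=> 0); first exact: tends_cst.
  by apply/funext => n; rewrite big_nil.
rewrite big_cons (_ : (fun _ => _) = (fun n => F i n + \sum_(i <- s) F i n)).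
  exact: tendsD.
by apply/funext => n; rewrite big_cons.
Qed.

Lemma tends_le u l c : (exists N, forall n, (N <= n)%N -> normc (u n) <= c) -> tends u l -> normc l <= c.
Proof.
move=> [M hu] ul; rewrite leNgt; apply/negP => lc.
have [|N hN] := ul (normc l - c); first by rewrite subr_gt0.
have := hN _ (leq_maxr M N); have := hu _ (leq_maxl M N); set n := maxn M N => h1 h2.
have := normcD (u n) (l - u n); rewrite addrC subrK [normc (l - _)]normcB; lra.
Qed.

Lemma tends_unique u l m : tends u l -> tends u m -> l = m.
Proof.
move=> ul um; apply/eqP; rewrite -subr_eq0; apply/eqP/normc0_eq0.
apply: (@tends_le (fun n => u n + -1 * u n)).
  by exists 0%N => n _; rewrite mulN1r subrr normc0.
by rewrite -[- m]mulN1r; apply: tendsD => //; apply: tendsZ.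
Qed.

(** Approximation arguments below close with this bound. If a exceeded b, taking e to be half of (a
    - b)/(c + 1) would give a - b <= c e < a - b. *)
Lemma le_of_eps (a b c : R) : 0 <= c -> (forall e, 0 < e -> a <= b + c * e) -> a <= b.
Proof.
move=> c0 h; rewrite leNgt; apply/negP => ba.
have := h ((a - b) / (c + 1) / 2); rewrite !divr_gt0 ?subr_gt0 //; last lra.
move=> /(_ isT); set t := (a - b) / (c + 1).
have t0 : 0 < t by rewrite divr_gt0 ?subr_gt0 //; lra.
have : t * (c + 1) = a - b by rewrite divfK // gt_eqF //; lra.
nra.
Qed.

Lemma geo_small r c e : 0 <= r < 1 -> 0 < e ->
  exists N, forall n, (N <= n)%N -> c * r ^+ n < e.
Proof.
move=> /andP[r0 r1] e0.
have : (fun n => c * r ^+ n) @ \oo --> c * 0.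
  by apply: cvgMr; apply: cvg_expr; rewrite ger0_norm.
rewrite mulr0 => /cvgrPdist_lt /(_ _ e0) [N _ hN]; exists N => n Nn.
have := hN n Nn; rewrite sub0r normrN => /(le_lt_trans _); apply; exact: ler_norm.
Qed.

Lemma tends_geo u l r c : 0 <= r < 1 ->
  (forall n, normc (u n - l) <= c * r ^+ n) -> tends u l.
Proof.
move=> r01 h e e0; have [N hN] := geo_small c r01 e0.
by exists N => n /hN; apply: le_lt_trans.
Qed.

Lemma geo_tail r n k : 0 <= r < 1 -> \sum_(n <= i < k) r ^+ i <= r ^+ n / (1 - r).
Proof.
move=> /andP[r0 r1]; have r1' : 0 < 1 - r by rewrite subr_gt0.
rewrite ler_pdivlMr //; have [nk|kn] := leqP n k; last first.
  by rewrite big_geq ?mul0r ?exprn_ge0 // ltnW.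
suff -> : (\sum_(n <= i < k) r ^+ i) * (1 - r) = r ^+ n - r ^+ k.
  by rewrite gerBl exprn_ge0.
rewrite big_distrl /= -[RHS]opprB -(@telescope_sumr _ n k (fun i => r ^+ i)) //.
by rewrite -sumrN; apply: eq_bigr => i _; rewrite exprS; ring.
Qed.

End Modulus.

(** * Hilbert space estimates *)

Section Cinner.
Variables (R : realType) (d : nat).
Local Notation C := R[i].
Implicit Types (x y z : 'cV[C]_d).

Lemma cinnerDZl (a : C) x y z : cinner (a *: x + y) z = a * cinner x z + cinner y z.
Proof.
rewrite /cinner mulr_sumr -big_split; apply: eq_bigr => i _ /=.
by rewrite !mxE mulrDl mulrA.
Qed.

Lemma cinner_conj x y : cinner y x = (cinner x y)^*.
Proof.
rewrite /cinner rmorph_sum; apply: eq_bigr => i _ /=.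
by rewrite rmorphM /= conjCK mulrC.
Qed.

Lemma cinner0l z : cinner 0 z = 0.
Proof. by rewrite /cinner big1 // => i _; rewrite mxE mul0r. Qed.

Lemma cinnerBl x y z : cinner (x - y) z = cinner x z - cinner y z.
Proof. by rewrite addrC -scaleN1r cinnerDZl mulN1r addrC. Qed.

Lemma cinner_delta x i : cinner x (delta_mx i 0) = x i 0.
Proof.
rewrite /cinner (bigD1 i) //= big1 => [|j ji]; last first.
  by rewrite mxE (negPf ji) rmorph0 mulr0.
by rewrite mxE !eqxx rmorph1 mulr1 addr0.
Qed.

Lemma cinner_inj x y : (forall z, cinner x z = cinner y z) -> x = y.
Proof.
by move=> h; apply/matrixP => i j; rewrite (ord1 j) -!cinner_delta.
Qed.

Definition adjmx (A : 'M[C]_d) : 'M[C]_d := \matrix_(i, j) (A j i)^*.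

Lemma cinner_mulmxl (A : 'M[C]_d) x y : cinner (A *m x) y = cinner x (adjmx A *m y).
Proof.
rewrite /cinner; under eq_bigr do rewrite mxE big_distrl /=.
rewrite exchange_big; apply: eq_bigr => j _ /=.
rewrite mxE rmorph_sum big_distrr /=; apply: eq_bigr => i _.
by rewrite mxE rmorphM /= conjCK; ring.
Qed.
End Cinner.

Section Hilbert.
Variables (R : realType) (d : nat) (K : Ball R d -> Ball R d -> 'M[R[i]]_d).
Variable H : RKHS K.
Local Notation C := R[i].
Local Notation memH := (Defs.mem H).
Local Notation F := (Ball R d -> 'cV[C]_d).
Implicit Types (f g h s p : F) (a b : C) (v w : 'cV[C]_d).
Local Notation "<< f , g >>" := (ip H f g) (format "<< f ,  g >>").

Lemma memDZ_fct a f g : memH f -> memH g -> memH (a *: f + g).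
Proof. exact: memDZ. Qed.

Lemma mem0_fct : memH 0. Proof. exact: mem0. Qed.

Lemma memD f g : memH f -> memH g -> memH (f + g).
Proof. by move=> hf hg; rewrite -[f]scale1r; exact: memDZ_fct. Qed.

Lemma memZ a f : memH f -> memH (a *: f).
Proof. by move=> hf; rewrite -[X in memH X]addr0; apply: memDZ_fct => //; exact: mem0_fct. Qed.

Lemma memB f g : memH f -> memH g -> memH (f - g).
Proof. by move=> hf hg; rewrite addrC -scaleN1r; exact: memDZ_fct. Qed.

Lemma mem_sum (I : Type) (r : seq I) (G : I -> F) :
  (forall i, memH (G i)) -> memH (\sum_(i <- r) G i).
Proof.
move=> h; elim: r => [|i r IH]; first by rewrite big_nil; exact: mem0_fct.
by rewrite big_cons; exact: memD.
Qed.

Hint Resolve memD memZ memB mem_sum mem0_fct mem_kfun : core.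

Lemma ipDl f g h : memH f -> memH g -> memH h -> << f + g, h >> = << f, h >> + << g, h >>.
Proof.
by move=> hf hg hh; rewrite -{1}[f]scale1r -[X in _ = X + _]mul1r -ipDZ.
Qed.

Lemma ip0l h : memH h -> << 0, h >> = 0.
Proof.
move=> hh; have := ipDl mem0_fct mem0_fct hh; rewrite addr0 => /eqP.
by rewrite -subr_eq0 opprD addrA subrr sub0r oppr_eq0 => /eqP.
Qed.

Lemma ipZl a f h : memH f -> memH h -> << a *: f, h >> = a * << f, h >>.
Proof.
move=> hf hh; rewrite -[X in << X, _ >>]addr0 -[X in _ = X]addr0.
by rewrite -[X in _ = _ + X](ip0l hh) -ipDZ.
Qed.

Lemma ipDr f g h : memH f -> memH g -> memH h -> << f, g + h >> = << f, g >> + << f, h >>.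
Proof.
move=> hf hg hh; rewrite (@ip_conj _ _ _ H (g + h)) ?ipDl ?rmorphD /=; auto.
by rewrite -!ip_conj.
Qed.

Lemma ipZr a f g : memH f -> memH g -> << f, a *: g >> = a^* * << f, g >>.
Proof.
move=> hf hg; rewrite (@ip_conj _ _ _ H (a *: g)) ?ipZl ?rmorphM /=; auto.
by rewrite -ip_conj.
Qed.

Lemma ipBr f g h : memH f -> memH g -> memH h -> << f, g - h >> = << f, g >> - << f, h >>.
Proof.
by move=> hf hg hh; rewrite -scaleN1r ipDr ?ipZr ?rmorphN1 ?mulN1r //=; auto.
Qed.

(** On members this is [hnorm], as an element of [R] instead of [R[i]]; see [hnormE]. *)
Definition nrm f : R := Num.sqrt (Re (<< f, f >>)).

Lemma nrm_ge0 f : 0 <= nrm f. Proof. exact: sqrtr_ge0. Qed.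

Lemma ipE f : memH f -> << f, f >> = (nrm f ^+ 2)%:C.
Proof.
move=> hf; have := ip_ge0 hf; rewrite /nrm.
case: (<< f, f >>) => x y; rewrite lecE /= => /andP[/eqP -> x0].
by rewrite sqr_sqrtr.
Qed.

Lemma hnormE f : memH f -> hnorm H f = (nrm f)%:C.
Proof.
move=> hf; rewrite /hnorm ipE // rmorphXn /= sqrCK // ler0c; exact: nrm_ge0.
Qed.

Lemma nrm_eq0 f : memH f -> nrm f = 0 -> f = 0.
Proof. by move=> hf h; apply: (ip_eq0 hf); rewrite ipE // h expr0n. Qed.

Lemma nrm0 : nrm 0 = 0.
Proof. by rewrite /nrm ip0l // sqrtr0. Qed.

Lemma nrm_sq f c : memH f -> 0 <= c -> (<< f, f >> = (c ^+ 2)%:C) -> nrm f = c.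
Proof. by move=> hf c0 h; rewrite /nrm h /= sqrtr_sqr ger0_norm. Qed.

Lemma nrmZ a f : memH f -> nrm (a *: f) = normc a * nrm f.
Proof.
move=> hf; apply: nrm_sq; auto; first by rewrite mulr_ge0 ?normc_ge0 ?nrm_ge0.
rewrite ipZl ?ipZr; auto; rewrite mulrA mul_conj ipE // -rmorphM /=.
by rewrite exprMn.
Qed.

Lemma nrmN f : memH f -> nrm (- f) = nrm f.
Proof.
by move=> hf; rewrite -scaleN1r nrmZ // normcN normc1 mul1r.
Qed.

Lemma nrmB f g : memH f -> memH g -> nrm (f - g) = nrm (g - f).
Proof. by move=> hf hg; rewrite -nrmN ?opprB //; auto. Qed.

Lemma nrmD_sq f g : memH f -> memH g ->
  nrm (f + g) ^+ 2 = nrm f ^+ 2 + nrm g ^+ 2 + 2 * Re (<< f, g >>).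
Proof.
move=> hf hg; apply: complexI; rewrite -ipE ?ipDl ?ipDr; auto.
have e c : c + c^* = (2 * Re c)%:C :> C by rewrite rmorphM rmorph_nat -[RHS]addcJ.
by rewrite (ip_conj hf hg) !ipE // !rmorphD -[X in _ = _ + X]e; ring.
Qed.

Lemma cauchy_schwarz f g : memH f -> memH g -> normc (<< f, g >>) <= nrm f * nrm g.
Proof.
move=> hf hg; have [g0|gN0] := eqVneq (nrm g) 0.
  by rewrite (nrm_eq0 hg g0) ip_conj // ip0l // rmorph0 nrm0 mulr0 normc0.
have gp : 0 < nrm g by rewrite lt_def gN0 nrm_ge0.
set c := << f, g >>; set q := nrm g.
(* With q = |g|, the vector q^2 f - <f, g> g has squared norm q^2 (q^2 |f|^2 - |<f, g>|^2), so no
   division by q is needed. *)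
have := sqr_ge0 (nrm ((q ^+ 2)%:C *: f + (- c) *: g)).
have e : << (q ^+ 2)%:C *: f, (- c) *: g >> = (- (q ^+ 2 * normc c ^+ 2))%:C.
  rewrite ipZl ?ipZr; auto; rewrite rmorphN /= mulNr [c^* * _]mulrC mul_conj.
  by rewrite -rmorphN -rmorphM mulrN.
rewrite nrmD_sq; auto; rewrite e !nrmZ // normcN normc_real ?sqr_ge0 //=.
rewrite -/q; set x : R := normc c; set y := nrm f => h.
have x0 : 0 <= x by exact: normc_ge0.
have y0 : 0 <= y by exact: nrm_ge0.
have : q ^+ 2 * (x ^+ 2) <= q ^+ 2 * (y * q) ^+ 2 by nra.
rewrite ler_pM2l ?exprn_gt0 // ler_pXn2r ?nnegrE ?mulr_ge0 //; exact: ltW.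
Qed.

Lemma Re_le_normc a : Re a <= normc a.
Proof.
case: a => x y /=; apply: (le_trans (ler_norm x)).
by rewrite -sqrtr_sqr ler_wsqrtr // lerDl sqr_ge0.
Qed.

Lemma nrmD f g : memH f -> memH g -> nrm (f + g) <= nrm f + nrm g.
Proof.
move=> hf hg; rewrite -(@ler_pXn2r _ 2) ?nnegrE ?addr_ge0 ?nrm_ge0 //.
rewrite nrmD_sq //; have := Re_le_normc (<< f, g >>).
have := cauchy_schwarz hf hg; nra.
Qed.

Lemma nrm_sum (I : Type) (r : seq I) (G : I -> F) :
  (forall i, memH (G i)) -> nrm (\sum_(i <- r) G i) <= \sum_(i <- r) nrm (G i).
Proof.
move=> hG; elim: r => [|i r IH]; first by rewrite !big_nil nrm0.
rewrite !big_cons; apply: le_trans (nrmD _ _) _; auto; by rewrite lerD2l.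
Qed.

Lemma complete_nrm (u : nat -> F) : (forall n, memH (u n)) ->
  (forall e : R, 0 < e -> exists N, forall m n, (N <= m)%N -> (N <= n)%N -> nrm (u m - u n) < e) ->
  exists2 f, memH f & forall e : R, 0 < e -> exists N, forall n, (N <= n)%N -> nrm (u n - f) < e.
Proof.
move=> hu cau; have [|f [hf fl]] := complete hu.
  (* A positive element of [R[i]] has zero imaginary part, so complex tolerances reduce to real
     ones. *)
  move=> eps; case: eps => e y; rewrite ltcE /= => /andP[/eqP -> e0].
  have [N hN] := cau _ e0; exists N => m n Nm Nn.
  by have := hN m n Nm Nn; rewrite -ltcR -hnormE //; auto.
exists f => // e e0; have [|N hN] := fl e%:C; first by rewrite ltcR.
by exists N => n Nn; rewrite -ltcR -hnormE; auto; exact: hN.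
Qed.

(** Orthogonal projection onto the closure of S: a sequence in S minimizing the distance to f is
    Cauchy, and its limit g leaves f - g orthogonal to S, so f = g by totality. *)
Lemma dense_of_total (S : F -> Prop) :
  (forall s, S s -> memH s) -> S 0 ->
  (forall a f g, S f -> S g -> S (a *: f + g)) ->
  (forall g, memH g -> (forall s, S s -> << g, s >> = 0) -> g = 0) ->
  forall f, memH f -> forall e, 0 < e -> exists2 s, S s & nrm (f - s) < e.
Proof.
move=> SH S0 SDZ tot f hf.
have SZ a f' : S f' -> S (a *: f') by move=> hs; rewrite -[X in S X]addr0; exact: SDZ.
pose E : set R := fun x => exists2 s, S s & x = nrm (f - s) ^+ 2.
have Elb : has_lbound E by exists 0 => _ [s _ ->]; exact: sqr_ge0.
have Einf : has_inf E by split => //; exists (nrm (f - 0) ^+ 2), 0.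
set del := inf E.
have del_le s : S s -> del <= nrm (f - s) ^+ 2 by move=> hs; apply: (ge_inf Elb); exists s.
have [iv [iv0 small]] : exists iv : nat -> R, (forall n, 0 < iv n) /\
    (forall e, 0 < e -> exists N, forall n, (N <= n)%N -> iv n < e).
  exists (fun n => n.+1%:R^-1); split=> [n|e e0]; first by rewrite invr_gt0 ltr0n.
  have := @cvg_harmonic R => /cvgrPdist_lt /(_ _ e0) [N _ hN].
  exists N => n Nn; have := hN n Nn; rewrite sub0r normrN ger0_norm //.
  by rewrite invr_ge0 ler0n.
have /choice [u hu] : forall n : nat, exists s, S s /\ nrm (f - s) ^+ 2 < del + iv n.
  move=> n; have [|_ [s hs ->]] := @inf_adherent _ E (iv n) _ Einf.
    exact: iv0.
  by exists s.
have uS n : S (u n) by case: (hu n).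
have uH n : memH (u n) by exact: SH.
have ud n : nrm (f - u n) ^+ 2 < del + iv n by case: (hu n).
have cau m n : nrm (u m - u n) ^+ 2 <= 2 * (iv m + iv n).
  (* Parallelogram law for f - u n and f - u m. Their half sum is f minus the midpoint of u n and u
     m, which lies in S, so its squared norm is at least [del]. *)
  have par : nrm (u m - u n) ^+ 2 + nrm ((f - u n) + (f - u m)) ^+ 2 =
             2 * nrm (f - u n) ^+ 2 + 2 * nrm (f - u m) ^+ 2.
    rewrite (_ : u m - u n = (f - u n) + (- (f - u m))); last by rewrite opprB [RHS]addrC addrA subrK.
    have : memH (f - u n) by auto.
    have : memH (f - u m) by auto.
    move: (f - u n) (f - u m) => x y hy hx.
    rewrite -[- y]scaleN1r !nrmD_sq ?nrmZ ?ipZr; auto.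
    by rewrite normcN normc1 rmorphN1 mulN1r raddfN /=; ring.
  have mid : nrm ((f - u n) + (f - u m)) ^+ 2 = 4 * nrm (f - (2^-1 *: u n + 2^-1 *: u m)) ^+ 2.
    rewrite (_ : _ + _ = (2%:R : C) *: (f - (2^-1 *: u n + 2^-1 *: u m))).
      rewrite nrmZ; auto; rewrite exprMn; congr (_ * _).
      by rewrite -[2%:R : C](rmorph_nat (real_complex R)) normc_real ?ler0n // -natrX.
    rewrite scalerBr scalerDr !scalerA divff ?pnatr_eq0 // !scale1r.
    by rewrite scaler_nat mulr2n opprD addrACA.
  have := del_le _ (SDZ 2^-1 _ _ (uS n) (SZ 2^-1 _ (uS m))).
  have := ud n; have := ud m; lra.
have [|g hg gl] := complete_nrm uH.
  move=> e e0; have [|N hN] := small (e ^+ 2 / 4).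
    by rewrite divr_gt0 ?exprn_gt0.
  exists N => m n Nm Nn; rewrite -(@ltr_pXn2r _ 2) ?nnegrE ?nrm_ge0 ?(ltW e0) //.
  have := cau m n; have := hN m Nm; have := hN n Nn; lra.
have perp s : S s -> << f - g, s >> = 0.
  move=> hs; have sH := SH s hs; apply: normc0_eq0.
  apply: (@le_of_eps _ _ _ (1 + nrm s)); first by have := nrm_ge0 s; lra.
  move=> e e0; set q := nrm s ^+ 2.
  have q0 : 0 <= q by exact: sqr_ge0.
  (* Minimality will give |b|^2 / (q + 1) <= iv n for b = <f - u n, s>; this tolerance turns that
     into |b| <= e. *)
  have [|N1 hN1] := small (e ^+ 2 / (q + 1)); first by rewrite divr_gt0 ?exprn_gt0 //; lra.
  have [N2 hN2] := gl _ e0; set n := maxn N1 N2.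
  have {hN1} := hN1 n (leq_maxl _ _); have {hN2} := hN2 n (leq_maxr _ _) => gn nn.
  have bn : normc (<< f - u n, s >>) <= e.
    (* Minimality of [del] against the competitor [u n + t b s] controls [b]. *)
    set b := << f - u n, s >>; pose t := (q + 1)^-1.
    have t0 : 0 < t by rewrite invr_gt0; lra.
    have tq : t * q = 1 - t by rewrite -[t in RHS]mulr1 /t; field; lra.
    have := del_le _ (SDZ (t%:C * b) _ _ hs (uS n)).
    rewrite (_ : f - _ = (f - u n) + (- (t%:C * b)) *: s); last first.
      by rewrite opprD scaleNr [- (_ *: _) - _]addrC addrA.
    have be : << f - u n, - (t%:C * b) *: s >> = (- (t * normc b ^+ 2))%:C.
      rewrite ipZr; auto; rewrite -/b rmorphN rmorphM /= conj_real mulNr.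
      by rewrite -mulrA [_^* * _]mulrC mul_conj -rmorphM -rmorphN.
    rewrite nrmD_sq ?be ?nrmZ; auto; rewrite normcN normcM normc_real ?(ltW t0) //=.
    rewrite exprMn -/q; set x := normc b => hd.
    have x0 : 0 <= x by exact: normc_ge0.
    have := ud n => udn.
    have : t * x ^+ 2 <= iv n.
      (* As t q = 1 - t, moving to the competitor lowers the squared distance by 2 t x^2 - t (1 - t)
         x^2 = t (1 + t) x^2, which is below iv n. *)
      have : (t * x * nrm s) ^+ 2 = t * x ^+ 2 * (t * q) by rewrite /q; ring.
      by rewrite tq => h1; rewrite -/q in hd; nra.
    move=> h1; rewrite -(@ler_pXn2r _ 2) ?nnegrE ?(ltW e0) //.
    move: nn; rewrite ltr_pdivlMr ?[q + 1]addrC => [nn|]; last lra.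
    have : (t * x ^+ 2) * (1 + q) <= e ^+ 2.
      by apply/ltW/(le_lt_trans _ nn); rewrite ler_wpM2r //; lra.
    by rewrite mulrAC /t [q + 1]addrC mulVf ?mul1r //; lra.
  rewrite (_ : f - g = (f - u n) + (u n - g)); last by rewrite addrA subrK.
  rewrite ipDl; auto; apply: le_trans (normcD _ _) _.
  have := cauchy_schwarz (memB (uH n) hg) sH; have := nrm_ge0 s; nra.
have /eqP := tot _ (memB hf hg) perp; rewrite subr_eq0 => /eqP fg e e0.
have [N hN] := gl e e0; exists (u N) => //.
by rewrite nrmB // fg; exact: hN.
Qed.

End Hilbert.

(** * Kernel functions and uniqueness of the space *)

Section KernelSpan.
Variables (R : realType) (d : nat) (K : Ball R d -> Ball R d -> 'M[R[i]]_d).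
Local Notation C := R[i].
Local Notation F := (Ball R d -> 'cV[C]_d).

(** The span refers to [K] alone, so it is a common dense subspace of any two spaces with kernel
    [K]. *)
Inductive kspan : F -> Prop :=
| kspan0 : kspan 0
| kspan_kfun w v : kspan (kfun K w v)
| kspanDZ (a : C) f g : kspan f -> kspan g -> kspan (a *: f + g).

Lemma kspan_mem (H : RKHS K) s : kspan s -> Defs.mem H s.
Proof.
elim=> [|w v|a f g _ hf _ hg]; [exact: mem0_fct|exact: mem_kfun|exact: memDZ_fct].
Qed.

Lemma kspan_total (H : RKHS K) g : Defs.mem H g ->
  (forall s, kspan s -> ip H g s = 0) -> g = 0.
Proof.
move=> hg h; apply/funext => w; apply: cinner_inj => v.
by rewrite cinner0l -(reproducing w v hg); apply: h; exact: kspan_kfun.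
Qed.

Lemma kspan_dense (H : RKHS K) f : Defs.mem H f -> forall e, 0 < e ->
  exists2 s, kspan s & nrm H (f - s) < e.
Proof.
apply: dense_of_total; [exact: kspan_mem|exact: kspan0|exact: kspanDZ|exact: kspan_total].
Qed.

(* A weak-compactness surrogate: the norm is lower semicontinuous along bounded
   pointwise convergent sequences, because the kernel functions span. *)
Lemma nrm_le_pointwise (H : RKHS K) (p : F) (h : nat -> F) (c : R) :
  Defs.mem H p -> (forall n, Defs.mem H (h n)) -> 0 <= c ->
  (exists N, forall n, (N <= n)%N -> nrm H (h n) <= c) ->
  (forall w i, tends (fun n => h n w i 0) (p w i 0)) ->
  nrm H p <= c.
Proof.
move=> hp hh c0 [N hc] hl.
(* Against a kernel function, <h n, s> converges by pointwise convergence; linearity extends this to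
   the span, and the bound on h n passes to the limit. *)
have hs s : kspan s -> normc (ip H p s) <= c * nrm H s.
  move=> ks; have hs := kspan_mem H ks.
  have: tends (fun n => ip H (h n) s) (ip H p s).
    elim: ks {hs} => [|w v|a f g kf hf kg hg].
    - rewrite (_ : (fun _ => _) = fun=> ip H p 0); first exact: tends_cst.
      by apply/funext => n; rewrite !(ip_conj (mem0_fct H)) // !ip0l.
    - rewrite (_ : (fun _ => _) = (fun n => cinner (h n w) v)).
        rewrite reproducing // /cinner; apply: tends_sum => i.
        rewrite mulrC (_ : (fun _ => _) = (fun n => (v i 0)^* * h n w i 0)).
          exact: tendsZ.
        by apply/funext => n; rewrite mulrC.
      by apply/funext => n; rewrite reproducing.
    - have {}kf := kspan_mem H kf; have {}kg := kspan_mem H kg.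
      have akf := memZ a kf.
      rewrite ipDr ?ipZr // (_ : (fun _ => _) = (fun n => a^* * ip H (h n) f + ip H (h n) g)).
        by apply: tendsD => //; exact: tendsZ.
      by apply/funext => n; rewrite ipDr ?ipZr.
  apply: tends_le; exists N => n /hc hn; apply: le_trans (cauchy_schwarz (hh n) hs) _.
  by rewrite ler_wpM2r ?nrm_ge0.
have [p0|pN0] := eqVneq (nrm H p) 0; first by rewrite p0.
have pp : 0 < nrm H p by rewrite lt_def pN0 nrm_ge0.
rewrite -(ler_pM2l pp); apply: (@le_of_eps _ _ _ (nrm H p + c)).
  by rewrite addr_ge0 ?nrm_ge0.
move=> e e0; have [s ks ps] := kspan_dense hp e0.
have sH := kspan_mem H ks; have psH := memB hp sH.
(* Split <p, p> as <p, p - s> + <p, s>: the parts are at most |p| e and c (|p| + e). *)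
have : nrm H p ^+ 2 <= normc (ip H p (p - s)) + normc (ip H p s).
  apply: le_trans (normcD _ _); rewrite -ipDr // subrK ipE //.
  by rewrite normc_real ?sqr_ge0.
have := cauchy_schwarz hp psH; have := hs _ ks.
have : nrm H s <= nrm H p + nrm H (p - s).
  rewrite [nrm H (p - s)]nrmB //; apply: le_trans (nrmD hp (memB sH hp)).
  by rewrite addrC subrK.
nra.
Qed.

Lemma kspan_ip (H H' : RKHS K) f s : Defs.mem H f -> Defs.mem H' f -> kspan s ->
  ip H f s = ip H' f s.
Proof.
move=> hf hf'; elim=> [|w v|a g h kg hg kh hh].
- by rewrite (ip_conj (mem0_fct H)) // (ip_conj (mem0_fct H')) // !ip0l.
- by rewrite !reproducing.
- have gm := kspan_mem H kg; have gm' := kspan_mem H' kg.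
  have hm := kspan_mem H kh; have hm' := kspan_mem H' kh.
  by rewrite !ipDr ?ipZr ?hg ?hh //; exact: memZ.
Qed.

Lemma kspan_nrm (H H' : RKHS K) s : kspan s -> nrm H s = nrm H' s.
Proof.
by move=> ks; rewrite /nrm (kspan_ip (H' := H')) //; exact: kspan_mem.
Qed.

Lemma kspanB f g : kspan f -> kspan g -> kspan (f - g).
Proof. by move=> kf kg; rewrite addrC -scaleN1r; exact: kspanDZ. Qed.

Lemma eval_le (H : RKHS K) f w v : Defs.mem H f ->
  normc (cinner (f w) v) <= nrm H f * nrm H (kfun K w v).
Proof. by move=> hf; rewrite -(reproducing w v hf); apply: cauchy_schwarz => //; exact: mem_kfun. Qed.

(** The two norms agree on the span, so a sequence in it converging to f in H is Cauchy in H'. Point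
    evaluations are bounded in both spaces, hence its limit in H' is again f. *)
Lemma RKHS_approx (H H' : RKHS K) f : Defs.mem H f -> Defs.mem H' f /\
  forall e, 0 < e -> exists s, [/\ kspan s, nrm H (f - s) < e & nrm H' (f - s) < e].
Proof.
move=> hf.
have /choice [u hu] : forall n : nat, exists s, kspan s /\ nrm H (f - s) < 2^-1 ^+ n.
  move=> n; have [|s ks hs] := kspan_dense hf (e := 2^-1 ^+ n); last by exists s.
  by rewrite exprn_gt0 // invr_gt0.
have ku n : kspan (u n) by case: (hu n).
have half : 0 <= (2^-1 : R) < 1 by apply/andP; split; lra.
have ul e : 0 < e -> exists N, forall n, (N <= n)%N -> nrm H (f - u n) < e.
  move=> e0; have [N hN] := geo_small 1 half e0; exists N => n /hN.
  by rewrite mul1r; apply: lt_trans; case: (hu n).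
have uH n := kspan_mem H (ku n); have uH' n := kspan_mem H' (ku n).
have [|g hg gl] := complete_nrm uH'.
  move=> e e0; have [|N hN] := ul (e / 2); first by rewrite divr_gt0.
  exists N => m n /hN hm /hN hn; rewrite -(kspan_nrm H); last exact: kspanB.
  rewrite (_ : u m - u n = (f - u n) - (f - u m)); last by rewrite opprB [RHS]addrC addrA subrK.
  rewrite -[- (f - u m)]scaleN1r; have h1 := memB hf (uH n); have h2 := memB hf (uH m).
  have h3 := memZ (-1) h2; apply: le_lt_trans (nrmD h1 h3) _.
  by rewrite nrmZ // normcN normc1 mul1r; lra.
have fg : f = g.
  apply/funext => w; apply: cinner_inj => v; apply/eqP; rewrite -subr_eq0; apply/eqP.
  have e1 h : cinner (f w) v - cinner (g w) v = cinner ((f - h) w) v + cinner ((h - g) w) v.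
    by rewrite -[(f - h) w]/(f w - h w) -[(h - g) w]/(h w - g w) !cinnerBl; ring.
  apply: normc0_eq0; apply: (@le_of_eps _ _ _ (nrm H (kfun K w v) + nrm H' (kfun K w v))).
    by rewrite addr_ge0 ?nrm_ge0.
  move=> e e0; have [N hN] := ul _ e0; have [M hM] := gl _ e0; set n := maxn N M.
  have {hN} := hN n (leq_maxl _ _); have {hM} := hM n (leq_maxr _ _) => h1 h2.
  rewrite (e1 (u n)) add0r; apply: le_trans (normcD _ _) _.
  have := eval_le w v (memB hf (uH n)); have := eval_le w v (memB (uH' n) hg).
  have := nrm_ge0 H (kfun K w v); have := nrm_ge0 H' (kfun K w v); nra.
rewrite -fg in hg gl *; split=> // e e0.
have [N hN] := ul _ e0; have [M hM] := gl _ e0; exists (u (maxn N M)); split=> //.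
  exact/hN/leq_maxl.
by rewrite nrmB //; exact/hM/leq_maxr.
Qed.

(** Replace g by an element of the span close to it in both norms; against the span, the reproducing
    property dictates both inner products. *)
Lemma RKHS_unique (H H' : RKHS K) f g : Defs.mem H f -> Defs.mem H g ->
  ip H f g = ip H' f g.
Proof.
move=> hf hg; have [hf' _] := RKHS_approx H' hf; have [hg' ap] := RKHS_approx H' hg.
apply/eqP; rewrite -subr_eq0; apply/eqP/normc0_eq0.
apply: (@le_of_eps _ _ _ (nrm H f + nrm H' f)); first by rewrite addr_ge0 ?nrm_ge0.
move=> e e0; have [s [ks sg sg']] := ap _ e0.
have hs := kspan_mem H ks; have hs' := kspan_mem H' ks.
have -> : ip H f g - ip H' f g = ip H f (g - s) - ip H' f (g - s).
  by rewrite !ipBr // (kspan_ip hf hf' ks); ring.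
rewrite add0r; apply: le_trans (normcD _ _) _; rewrite normcN.
have := cauchy_schwarz hf (memB hg hs); have := cauchy_schwarz hf' (memB hg' hs').
have := nrm_ge0 H f; have := nrm_ge0 H' f; nra.
Qed.

Lemma unitarily_equivalent_same_kernel (H H' : RKHS K) : unitarily_equivalent H H'.
Proof.
exists id; split=> //.
- by move=> f hf; case: (RKHS_approx H' hf).
- by move=> f g hf hg; rewrite (RKHS_unique H').
- by move=> g hg; exists g => //; case: (RKHS_approx H hg).
Qed.

End KernelSpan.

(** * Homogeneous expansions *)

Section MatrixLimits.
Variable R : realType.
Local Notation C := R[i].

Definition mtends (m n : nat) (u : nat -> 'M[C]_(m, n)) (L : 'M[C]_(m, n)) :=
  forall i j, tends (fun t => u t i j) (L i j).

Lemma mtends_mulmx (m n p : nat) (A : 'M[C]_(m, n)) (u : nat -> 'M[C]_(n, p)) L :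
  mtends u L -> mtends (fun t => A *m u t) (A *m L).
Proof.
move=> h i j; rewrite mxE (_ : (fun _ => _) = (fun t => \sum_k A i k * u t k j)).
  by apply: tends_sum => k; apply: tendsZ; exact: h.
by apply/funext => t; rewrite mxE.
Qed.

Lemma mtends_mulmxr (m n p : nat) (A : 'M[C]_(n, p)) (u : nat -> 'M[C]_(m, n)) L :
  mtends u L -> mtends (fun t => u t *m A) (L *m A).
Proof.
move=> h i j; rewrite mxE (_ : (fun _ => _) = (fun t => \sum_k u t i k * A k j)).
  apply: tends_sum => k; rewrite mulrC (_ : (fun _ => _) = (fun t => A k j * u t i k)).
    by apply: tendsZ; exact: h.
  by apply/funext => t; rewrite mulrC.
by apply/funext => t; rewrite mxE.
Qed.

Lemma mtends_unique (m n : nat) (u : nat -> 'M[C]_(m, n)) L L' :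
  mtends u L -> mtends u L' -> L = L'.
Proof. by move=> h h'; apply/matrixP => i j; exact: tends_unique (h i j) (h' i j). Qed.

Lemma series_terms_bounded (u : nat -> C) L :
  tends (fun n => \sum_(l < n) u l) L -> exists2 c, 0 <= c & forall l, normc (u l) <= c.
Proof.
move=> /(_ 1 ltr01) [N hN].
(* From N on, consecutive partial sums lie within 1 of L, so their difference is below 2; the
   finitely many earlier terms are bounded by the sum of their moduli. *)
exists (2 + \sum_(l < N) normc (u l)).
  by rewrite addr_ge0 // sumr_ge0 // => i _; exact: normc_ge0.
move=> l; have [lN|Nl] := ltnP l N.
  rewrite (bigD1 (Ordinal lN)) //=.
  have : 0 <= \sum_(i < N | i != Ordinal lN) normc (u i).
    by apply: sumr_ge0 => i _; exact: normc_ge0.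
  lra.
have : 0 <= \sum_(i < N) normc (u i) by apply: sumr_ge0 => i _; exact: normc_ge0.
have h1 := hN _ Nl; have h2 := hN _ (leq_trans Nl (leqnSn l)).
rewrite big_ord_recr /= in h2.
have := normcD (\sum_(i < l) u i + u l - L) (L - \sum_(i < l) u i).
by rewrite [normc (L - _)]normcB [X in normc X <= _](_ : _ = u l); [lra | ring].
Qed.

Lemma series_tail (u : nat -> C) L c r n : 0 <= r < 1 -> 0 <= c ->
  (forall l, normc (u l) <= c * r ^+ l) -> tends (fun n => \sum_(l < n) u l) L ->
  normc (L - \sum_(l < n) u l) <= c / (1 - r) * r ^+ n.
Proof.
move=> r01 c0 hu /(tendsD (tends_cst (- \sum_(l < n) u l))) ul.
rewrite addrC; apply: tends_le ul; exists n => m nm.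
rewrite -!(big_mkord xpredT u) (big_cat_nat _ nm) //= addKr.
apply: le_trans (normc_sum _ _ _) _.
apply: le_trans (ler_sum _ (fun i _ => hu i)) _.
rewrite -mulr_sumr -mulrA ler_wpM2l // mulrC; exact: geo_tail.
Qed.

(** [R[i]] is algebraically closed and X^(n+1) - 1 is separable in characteristic zero, so its n+1
    distinct roots include a primitive one. The shift by one excludes order 0. *)
Lemma unity_roots : exists om : nat -> C, forall n, n.+1.-primitive_root (om n).
Proof.
suff /choice [om hom] : forall n, exists z : C, n.+1.-primitive_root z by exists om.
move=> n.
pose p : {poly C} := 'X^(n.+1) - 1; have [r Dp] := closed_field_poly_normal p.
rewrite (monicP _) ?monicXnsubC // scale1r in Dp.
have rn1 : all n.+1.-unity_root r by apply/allP=> z; rewrite -root_prod_XsubC -Dp.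
have sz_r : (n.+1 < (size r).+1)%N by rewrite -(size_prod_XsubC r id) -Dp size_XnsubC.
have [|z] := hasP (has_prim_root (ltn0Sn n) rn1 _ sz_r); last by exists z.
by rewrite -separable_prod_XsubC -Dp separable_Xn_sub_1 // pnatr_eq0.
Qed.

Lemma prim_root_normc n (z : C) : n.-primitive_root z -> normc z = 1.
Proof.
move=> hz; have n0 := prim_order_gt0 hz.
have := congr1 (@normc R) (prim_expr_order hz); rewrite normcX normc1 => /eqP.
by rewrite pexpr_eq1 ?normc_ge0 // => /eqP.
Qed.

(** Orthogonality of the characters of a cyclic group. On the unit circle conjugation is inversion,
    so the sum is geometric of ratio x = z^l / z^m; for l != m, x differs from 1 while x^n = 1. *)
Lemma prim_root_orthogonal n (z : C) l m : n.-primitive_root z -> (l < n)%N -> (m < n)%N ->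
  \sum_(t < n) (z ^+ t) ^+ l * ((z ^+ t)^*) ^+ m = if l == m then n%:R else 0.
Proof.
move=> hz ln mn; have zz : z^* = z^-1.
  have h := mul_conj z; rewrite (prim_root_normc hz) expr1n in h.
  have z0 : z != 0 by apply: contra_eq_neq h => ->; rewrite mul0r eq_sym oner_eq0.
  by apply: (mulfI z0); rewrite h divff.
have z0 : z != 0 by apply: contra_eq_neq (prim_root_normc hz) => ->; rewrite normc0 eq_sym oner_eq0.
under eq_bigr => t _ do rewrite rmorphXn /= zz -!exprM mulnC [(t * m)%N]mulnC !exprM -exprMn exprVn.
have [<-|lm] := eqVneq l m.
  rewrite divff ?expf_neq0 //; under eq_bigr do rewrite expr1n.
  by rewrite sumr_const card_ord.
set x := z ^+ l / z ^+ m; have x1 : x - 1 != 0.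
  rewrite subr_eq0 /x; apply: contra lm => /eqP h.
  have /eqP : z ^+ l = z ^+ m by rewrite -[RHS]mul1r -h divfK // expf_neq0.
  by rewrite (eq_prim_root_expr hz) !modn_small.
apply: (mulfI x1); rewrite -subrX1 mulr0 /x exprMn exprVn -!exprM.
by rewrite mulnC [(m * n)%N]mulnC !exprM (prim_expr_order hz) !expr1n invr1 mulr1 subrr.
Qed.

End MatrixLimits.

(** * Extraction of homogeneous components by averaging over roots of unity *)

Section Homogeneous.
Variables (R : realType) (d : nat).
Local Notation C := R[i].
Local Notation Bd := (Ball R d).
Local Notation F := (Bd -> 'cV[C]_d).
Implicit Types z w : Bd.

Lemma cinnerZ (a b : C) (x y : 'cV[C]_d) : cinner (a *: x) (b *: y) = a * b^* * cinner x y.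
Proof.
rewrite /cinner mulr_sumr; apply: eq_bigr => i _.
by rewrite !mxE rmorphM /=; ring.
Qed.

(* Only meaningful for [|a| = 1]; otherwise [insubd] may return [w] itself. *)
Definition rotate (a : C) (w : Bd) : Bd := insubd w (a *: val w).

Lemma val_rotate a w : normc a = 1 -> val (rotate a w) = a *: val w.
Proof.
move=> a1; rewrite val_insubd /in_ball cinnerZ mul_conj a1 expr1n mul1r.
by rewrite ifT //; exact: (valP w).
Qed.

Lemma cinner_ge0 (x : 'cV[C]_d) : 0 <= cinner x x.
Proof. by apply: sumr_ge0 => i _; rewrite mul_conj ler0c sqr_ge0. Qed.

(** The factor r supplies the decay r^l of the degree l components at w, given mere boundedness at
    w'. *)
Lemma ball_shrink (w : Bd) : exists2 r : R, 0 < r < 1 & exists w' : Bd, val w = r%:C *: val w'.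
Proof.
have := cinner_ge0 (val w); have := valP w; rewrite /= /in_ball.
case e : (cinner (val w) (val w)) => [q y]; rewrite ltcE lecE /= => /andP[_ q1] /andP[/eqP y0 q0].
have r0 : 0 < (1 + q) / 2 by lra.
(* With q = |w|^2, r^2 - q = (1 - q)^2 / 4 > 0, so w / r stays in the ball; r is positive even for w
   = 0. *)
set r := (1 + q) / 2 in r0 *; have rC : r%:C != 0 :> C by rewrite fmorph_eq0 gt_eqF.
exists r; first by rewrite r0 /r; lra.
have {}e : cinner (val w) (val w) = q%:C by rewrite e y0.
have hw : in_ball (r%:C^-1 *: val w).
  rewrite /in_ball cinnerZ -fmorphV conj_real e -!rmorphM -[1]/(1%:C) ltcR.
  rewrite -invfM mulrC ltr_pdivrMr ?mul1r /r; last by nra.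
  have : 0 < (1 - q) ^+ 2 by rewrite exprn_gt0 // subr_gt0.
  by move=> ?; nra.
by exists (exist (@in_ball R d) _ hw); rewrite /= scalerA divff // scale1r.
Qed.

(** Vector-valued polynomials, generated by exactly the operations that preserve membership in the
    space and that a unitary intertwiner respects. *)
Inductive pol : F -> Prop :=
| pol_const v : pol (fun=> v)
| polDZ (a : C) f g : pol f -> pol g -> pol (a *: f + g)
| pol_mult i f : pol f -> pol (mult_coord i f).

(** What both forms of kernel share and what the density argument uses. The components live on all
    of C^d, so scaling never leaves their domain. *)
Record hom_expansion (K : Bd -> Bd -> 'M[C]_d) (k : nat -> 'cV[C]_d -> 'cV[C]_d -> 'M[C]_d) : Prop := {
  hom_cvg : forall z w : Bd, mtends (fun n => \sum_(l < n) k l (val z) (val w)) (K z w);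
  hom_l : forall l (a : C) (z w : 'cV[C]_d), k l (a *: z) w = a ^+ l *: k l z w;
  hom_r : forall l (a : C) (z w : 'cV[C]_d), k l z (a *: w) = (a^*) ^+ l *: k l z w;
  hom_pol : forall l (w v : 'cV[C]_d), pol (fun z => k l (val z) w *m v) }.

(** The weight a^l cancels the factor conj(a)^l that rotating w by a gives the degree l component.
    The order n + l + 1 exceeds l for every n. *)
Definition component_avg (om : nat -> C) (K : Bd -> Bd -> 'M[C]_d) l n z w : 'M[C]_d :=
  (n + l).+1%:R^-1 *: \sum_(t < (n + l).+1) (om (n + l)%N ^+ t) ^+ l *: K z (rotate (om (n + l)%N ^+ t) w).

Variable om : nat -> C.
Hypothesis prim_om : forall n, n.+1.-primitive_root (om n).

Lemma normc_om n t : normc (om n ^+ t) = 1.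
Proof. by rewrite normcX (prim_root_normc (prim_om n)) expr1n. Qed.

Variables (K : Bd -> Bd -> 'M[C]_d) (k : nat -> 'cV[C]_d -> 'cV[C]_d -> 'M[C]_d).
Hypothesis hK : hom_expansion K k.

(** Abel's argument: the terms of the convergent series at w' are bounded, and w = r w' multiplies
    the l-th one by r^l. *)
Lemma hom_bound z w i j : exists c r, [/\ 0 <= c, 0 <= r < 1 &
  forall l, normc (k l (val z) (val w) i j) <= c * r ^+ l].
Proof.
have [r r01 [w' ew]] := ball_shrink w; have /andP[r0 r1] := r01.
have [|c c0 hc] := @series_terms_bounded _ (fun l => k l (val z) (val w') i j) (K z w' i j).
  have := hom_cvg hK z w' i j.
  by congr tends; apply/funext => n; rewrite summxE.
exists c, r; rewrite (ltW r0) r1; split=> // l.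
rewrite ew (hom_r hK) mxE normcM normcX normc_conj normc_real ?(ltW r0) // mulrC.
by rewrite ler_wpM2r // exprn_ge0 // ltW.
Qed.

(** By orthogonality only degree l survives among the first N degrees. Higher degrees congruent to l
    modulo N do contribute, but they belong to a remainder of order r^N. *)
Lemma component_avg_cvg l z w :
  mtends (fun n => component_avg om K l n z w) (k l (val z) (val w)).
Proof.
move=> i j; have [c [r [c0 r01 hc]]] := hom_bound z w i j.
apply: (@tends_geo _ _ _ _ (c / (1 - r)) r01) => n.
set N := (n + l).+1; set o := om (n + l)%N.
have N0 : N%:R != 0 :> C by rewrite pnatr_eq0.
have o1 t : normc (o ^+ t) = 1 by exact: normc_om.
have oN : N.-primitive_root o by exact: prim_om.
(* The remainder after N terms at a rotated point; rotation preserves the moduli of the terms, so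
   one geometric bound serves all t. *)
pose T t := K z (rotate (o ^+ t) w) i j - \sum_(m < N) k m (val z) (val (rotate (o ^+ t) w)) i j.
have hT t : normc (T t) <= c / (1 - r) * r ^+ N.
  apply: (@series_tail _ (fun m => k m (val z) (val (rotate (o ^+ t) w)) i j) _ _ _ N r01 c0).
    move=> m; rewrite (val_rotate _ (o1 t)) (hom_r hK) mxE normcM normcX normc_conj o1 expr1n mul1r.
    exact: hc.
  have := hom_cvg hK z (rotate (o ^+ t) w) i j.
  by congr tends; apply/funext => m; rewrite summxE.
have E : component_avg om K l n z w i j - k l (val z) (val w) i j =
    N%:R^-1 * \sum_(t < N) (o ^+ t) ^+ l * T t.
  rewrite /component_avg -/N -/o mxE summxE; apply: (mulfI N0); rewrite mulrBr !mulrA divff // !mul1r.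
  apply/eqP; rewrite subr_eq -subr_eq0 opprD addrA -sumrB subr_eq0; apply/eqP.
  transitivity (\sum_(t < N) \sum_(m < N) (o ^+ t) ^+ l * ((o ^+ t)^*) ^+ m * k m (val z) (val w) i j).
    apply: eq_bigr => t _; rewrite mxE /T mulrBr opprB addrC subrK mulr_sumr.
    by apply: eq_bigr => m _; rewrite (val_rotate _ (o1 t)) (hom_r hK) mxE mulrA.
  have lN : (l < N)%N by rewrite ltnS leq_addl.
  rewrite exchange_big (bigD1 (Ordinal lN)) //= [X in _ + X]big1 ?addr0 => [|m ml].
    by rewrite -mulr_suml (prim_root_orthogonal oN) // eqxx.
  rewrite -mulr_suml (prim_root_orthogonal oN) // ifN ?mul0r // eq_sym.
  by apply: contra ml => /eqP e; apply/eqP/val_inj.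
have r0 : 0 <= r by case/andP: r01.
have r1 : 0 < 1 - r by rewrite subr_gt0; case/andP: r01.
have c1 : 0 <= c / (1 - r) by rewrite divr_ge0 // ltW.
have rN : r ^+ N <= r ^+ n.
  by apply: ler_wiXn2l => //; [case/andP: r01 => _ /ltW|rewrite leqW // leq_addr].
rewrite E normcM normcV -[N%:R](rmorph_nat (real_complex R)) normc_real ?ler0n //.
rewrite mulrC ler_pdivrMr ?ltr0n //.
apply: le_trans (normc_sum _ _ _) _.
apply: le_trans (ler_sum (G := fun=> c / (1 - r) * r ^+ n) _ _) _.
  move=> t _; rewrite normcM normcX o1 expr1n mul1r; apply: le_trans (hT t) _.
  by rewrite ler_wpM2l.
by rewrite sumr_const card_ord mulr_natr.
Qed.

Lemma kernel_rotate a w : normc a = 1 -> K (rotate a w) (rotate a w) = K w w.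
Proof.
move=> a1; apply: (mtends_unique (hom_cvg hK _ _)).
rewrite (_ : (fun _ => _) = (fun n => \sum_(l < n) k l (val w) (val w))); first exact: hom_cvg.
apply/funext => n; apply: eq_bigr => l _; rewrite val_rotate // (hom_l hK) (hom_r hK) scalerA.
by rewrite -exprMn mul_conj a1 !expr1n scale1r.
Qed.

End Homogeneous.

(** * Density of polynomials *)

Section PolynomialDensity.
Variables (R : realType) (d : nat).
Local Notation C := R[i].
Local Notation Bd := (Ball R d).
Local Notation F := (Bd -> 'cV[C]_d).
Implicit Types z w : Bd.
Variables (K : Bd -> Bd -> 'M[C]_d) (k : nat -> 'cV[C]_d -> 'cV[C]_d -> 'M[C]_d).
Hypotheses (hK : hom_expansion K k) (nK : normalized_kernel K).
Variable H : RKHS K.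
Hypothesis bH : bounded_mult H.
Local Notation memH := (Defs.mem H).

(** Normalization makes the constants kernel functions at the origin, so they lie in the space and
    pairing with them evaluates at the origin. *)
Lemma kfun0 v : kfun K (Defs.ball0 R d) v = fun=> v.
Proof. by apply/funext => z; rewrite /kfun nK mul1mx. Qed.

Lemma pol_mem f : pol f -> memH f.
Proof.
elim=> [v|a g h _ hg _ hh|i g _ hg]; first by rewrite -kfun0; exact: mem_kfun.
  exact: memDZ_fct.
by have [h _] := bH i; exact: h.
Qed.

Lemma ip_const f v : memH f -> ip H f (fun=> v) = cinner (f (Defs.ball0 R d)) v.
Proof. by move=> hf; rewrite -kfun0 reproducing. Qed.

Lemma nrm_kfun_rotate a w v : normc a = 1 -> nrm H (kfun K (rotate a w) v) = nrm H (kfun K w v).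
Proof.
move=> a1; rewrite /nrm !reproducing; try exact: mem_kfun.
by rewrite /kfun (kernel_rotate hK).
Qed.

(** The averages [g n] have unimodular weights and rotated kernel functions of equal norm, so
    [nrm_le_pointwise] applies; the limit is a member because it is a polynomial. *)
Lemma nrm_component_le l w v :
  nrm H (fun z => k l (val z) (val w) *m v) <= nrm H (kfun K w v).
Proof.
have [om prim_om] := unity_roots R; have om1 := normc_om prim_om.
pose c n t : C := (om (n + l)%N ^+ t) ^+ l.
pose g n : F := (n + l).+1%:R^-1 *: \sum_(t < (n + l).+1) c n t *: kfun K (rotate (om (n + l)%N ^+ t) w) v.
have cm n t : memH (c n t *: kfun K (rotate (om (n + l)%N ^+ t) w) v).
  by apply: memZ; exact: mem_kfun.
have gm n : memH (g n) by apply: memZ; apply: mem_sum => t; exact: cm.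
apply: (@nrm_le_pointwise _ _ _ H _ g) => //; first exact/pol_mem/(hom_pol hK).
- exact: nrm_ge0.
- exists 0%N => n _; rewrite nrmZ; last by apply: mem_sum => t; exact: cm.
  rewrite normcV -[_%:R](rmorph_nat (real_complex R)) normc_real ?ler0n //.
  rewrite mulrC ler_pdivrMr ?ltr0n //; apply: le_trans (nrm_sum _ _) _ => //.
  rewrite (eq_bigr (fun=> nrm H (kfun K w v))) => [|t _].
    by rewrite sumr_const card_ord mulr_natr.
  rewrite nrmZ; last exact: mem_kfun.
  by rewrite /c normcX om1 expr1n mul1r nrm_kfun_rotate // om1.
- move=> z i; have := mtends_mulmxr v (component_avg_cvg prim_om hK l z w) i 0.
  congr tends; apply/funext => n; congr (fun_of_matrix _ i 0).
  rewrite /component_avg -scalemxAl mulmx_suml /g.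
  rewrite [RHS]/(_ *: (\sum_(t < (n + l).+1) c n t *: kfun K (rotate (om (n + l)%N ^+ t) w) v) z).
  rewrite fct_sumE; congr (_ *: _); apply: eq_bigr => t _.
  by rewrite -scalemxAl.
Qed.

(** With w = r w', the polynomials [s n] are the partial sums of K(., w)v, the sum of the r^l k_l(.,
    w')v. They approach it in norm, so orthogonality to polynomials forces <f(w), v> = 0. *)
Lemma pol_total f : memH f -> (forall p, pol p -> ip H f p = 0) -> f = 0.
Proof.
move=> hf fp; apply/funext => w; apply: cinner_inj => v; rewrite cinner0l -(reproducing w v hf).
have [r r01 [w' ew]] := ball_shrink w; have /andP[r0 r1] := r01.
have r01' : 0 <= r < 1 by rewrite ltW.
pose p l : F := fun z => k l (val z) (val w') *m v.
have pp l : pol (p l) by exact: (hom_pol hK).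
pose s n : F := \sum_(l < n) (r ^+ l)%:C *: p l.
have sp n : pol (s n).
  rewrite /s; elim: n => [|n IH]; first by rewrite big_ord0; exact: (pol_const 0).
  by rewrite big_ord_recr /= addrC; exact: polDZ.
have sm n := pol_mem (sp n).
set B := nrm H (kfun K w' v).
have B0 : 0 <= B by exact: nrm_ge0.
have r1' : 0 < 1 - r by rewrite subr_gt0.
have wm : memH (kfun K w v) by exact: mem_kfun.
have diff n m : (n <= m)%N -> nrm H (s m - s n) <= B / (1 - r) * r ^+ n.
  move=> nm; rewrite /s -!(big_mkord xpredT (fun l => (r ^+ l)%:C *: p l)).
  rewrite (big_cat_nat _ nm) //= addrAC subrr add0r.
  apply: le_trans (nrm_sum _ _) _; first by move=> l; exact/memZ/pol_mem.
  apply: le_trans (ler_sum (G := fun l => B * r ^+ l) _ _) _ => [l _|].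
    have rl : 0 <= r ^+ l by rewrite exprn_ge0 // ltW.
    rewrite nrmZ; last exact: pol_mem.
    by rewrite normc_real // mulrC ler_wpM2r //; exact: nrm_component_le.
  by rewrite -mulr_sumr -mulrA ler_wpM2l // mulrC; exact: geo_tail.
have app n : nrm H (kfun K w v - s n) <= B / (1 - r) * r ^+ n.
  (* The series is known to converge to K(., w)v only pointwise; lower semicontinuity carries the
     bound on s m - s n to the full remainder. *)
  apply: (@nrm_le_pointwise _ _ _ H _ (fun m => s m - s n)); first exact: memB.
  - by move=> m; exact: memB.
  - by rewrite mulr_ge0 ?divr_ge0 ?exprn_ge0 // ltW.
  - by exists n => m; exact: diff.
  - move=> z i; rewrite [X in tends _ X](_ : _ = (K z w *m v) i 0 + - s n z i 0); last by rewrite !mxE.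
    rewrite (_ : (fun _ => _) = (fun m => s m z i 0 + - s n z i 0)); last first.
      by apply/funext => m; rewrite !mxE.
    apply: tendsD; last exact: tends_cst.
    have := mtends_mulmxr v (hom_cvg hK z w) i 0; congr tends; apply/funext => m.
    rewrite /s fct_sumE mulmx_suml; congr (fun_of_matrix _ i 0); apply: eq_bigr => l _.
    rewrite [RHS]/(_ *: p l z) /p ew (hom_r hK) conj_real -scalemxAl.
    by rewrite rmorphXn.
apply: normc0_eq0; apply: (@le_of_eps _ _ _ (nrm H f)); first exact: nrm_ge0.
move=> e e0; have [N hN] := geo_small (B / (1 - r)) r01' e0.
have {hN} := hN N (leqnn _) => hN.
rewrite (_ : ip H f _ = ip H f (kfun K w v - s N)); last by rewrite ipBr // (fp _ (sp N)) subr0.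
rewrite add0r; apply: le_trans (cauchy_schwarz hf (memB wm (sm N))) _.
by rewrite ler_wpM2l ?nrm_ge0 //; apply: le_trans (app N) _; exact: ltW.
Qed.

(** The hypothesis states, without forming adjoints, that every adjoint of M_i kills f. Then f -
    f(0) is orthogonal to constants, being zero at the origin, and to each z_i g, since z_i g also
    vanishes there. *)
Lemma joint_kernel_const f : memH f ->
  (forall i g, memH g -> ip H (mult_coord i g) f = 0) -> f = fun=> f (Defs.ball0 R d).
Proof.
move=> hf hz; set c := fun=> _.
have cm : memH c by rewrite /c -kfun0; exact: mem_kfun.
have fc := memB hf cm.
have mm i g : memH g -> memH (mult_coord i g) by have [h _] := bH i; exact: h.
have z0 i g : mult_coord i g (Defs.ball0 R d) = 0 by rewrite /mult_coord /= mxE scale0r.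
apply/eqP; rewrite -subr_eq0; apply/eqP/pol_total => // p pp.
have pm := pol_mem pp; rewrite ip_conj // [ip _ _ _](_ : _ = 0) ?rmorph0 //.
elim: pp {pm} => [v|a g h pg hg ph hh|i g pg _].
- rewrite ip_conj //; last by rewrite -kfun0; exact: mem_kfun.
  by rewrite ip_const // [_ (Defs.ball0 R d)]subrr cinner0l rmorph0.
- have gm := pol_mem pg; have hm := pol_mem ph; have agm := memZ a gm.
  by rewrite ipDl ?ipZl // hg hh mulr0 addr0.
- have gm := pol_mem pg; have gm' := mm i _ gm.
  by rewrite ipBr // hz // ip_const // z0 cinner0l subr0.
Qed.

End PolynomialDensity.

(** * Unitary equivalence and conjugation by a matrix *)

Lemma mulmx_cV_inj (T : pzRingType) (m n : nat) (M N : 'M[T]_(m, n)) :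
  (forall y : 'cV_n, M *m y = N *m y) -> M = N.
Proof.
move=> h; apply/matrixP => i j.
by have /matrixP/(_ i 0) := h (delta_mx j 0); rewrite -!colE !mxE.
Qed.

Section ConjugateKernel.
Variables (R : realType) (d : nat).
Local Notation C := R[i].
Local Notation Bd := (Ball R d).
Local Notation F := (Bd -> 'cV[C]_d).
Local Notation o := (Defs.ball0 R d).
Implicit Types z w : Bd.
Variables (K K' : Bd -> Bd -> 'M[C]_d) (k k' : nat -> 'cV[C]_d -> 'cV[C]_d -> 'M[C]_d).
Hypotheses (hK : hom_expansion K k) (nK : normalized_kernel K).
Hypotheses (hK' : hom_expansion K' k') (nK' : normalized_kernel K').
Variables (H : RKHS K) (H' : RKHS K').
Hypotheses (bH : bounded_mult H) (bH' : bounded_mult H').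

Lemma unitary_conjugate_kernel : unitarily_equivalent H H' ->
  exists2 A : 'M[C]_d, adjmx A *m A = 1%:M & forall z w, K' z w = A *m K z w *m adjmx A.
Proof.
case=> U [UH Ulin Uip Usurj Um].
have cH v : Defs.mem H (fun=> v) by rewrite -(kfun0 nK); exact: mem_kfun.
(* The image of a constant is in the joint kernel: writing g = U f, <z_i g, U v> = <z_i f, v>, which
   is evaluation of z_i f at the origin. *)
have U0 v : U (fun=> v) = fun=> U (fun=> v) o.
  apply: (joint_kernel_const hK' nK' bH') => [|i g hg]; first exact: UH.
  have [f hf <-] := Usurj _ hg; have [mf _] := bH i; rewrite -Um // Uip //; last exact: mf.
  by rewrite (ip_const nK) ?/mult_coord /= ?mxE ?scale0r ?cinner0l //; exact: mf.
pose T v := U (fun=> v) o.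
have Tlin a x y : T (a *: x + y) = a *: T x + T y.
  by rewrite /T (Ulin a _ _ (cH x) (cH y)).
have T0 : T 0 = 0.
  have := Tlin 1 0 0; rewrite !scale1r addr0 => /eqP.
  by rewrite -subr_eq0 opprD addrA subrr sub0r oppr_eq0 => /eqP.
pose A : 'M[C]_d := \matrix_(i, j) T (delta_mx j 0) i 0.
have TA v : T v = A *m v.
  have Tsum (r : seq 'I_d) : T (\sum_(j <- r) v j 0 *: delta_mx j 0) =
      \sum_(j <- r) v j 0 *: T (delta_mx j 0).
    by elim: r => [|j r IH]; rewrite ?big_nil // !big_cons Tlin IH.
  have -> : v = \sum_j v j 0 *: delta_mx j 0.
    apply/matrixP => i j; rewrite ord1 summxE (bigD1 i) //= big1 => [|t ti].
      by rewrite !mxE !eqxx mulr1 addr0.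
    by rewrite !mxE eq_sym (negPf ti) mulr0.
  rewrite Tsum; apply/matrixP => i j; rewrite ord1 mulmx_sumr !summxE.
  apply: eq_bigr => t _; rewrite -scalemxAr !mxE; congr (_ * _).
  rewrite (bigD1 t) //= big1 => [|s st]; first by rewrite !mxE !eqxx mulr1 addr0.
  by rewrite !mxE (negPf st) mulr0.
have UA v : U (fun=> v) = fun=> A *m v by rewrite U0 -TA.
(* The inner product of two constants is that of C^d, in both spaces. *)
have iso x y : cinner (A *m x) (A *m y) = cinner x y.
  by rewrite -(ip_const nK y (cH x)) -Uip // !UA (ip_const nK') // -UA; exact: UH.
have AA : adjmx A *m A = 1%:M.
  apply: mulmx_cV_inj => y; rewrite -mulmxA mul1mx; apply: cinner_inj => x.
  by rewrite cinner_conj -cinner_mulmxl iso -cinner_conj.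
have Upol p : pol p -> U p = fun z => A *m p z.
  elim=> [v|a f g pf Uf pg Ug|i f pf Uf] //.
  - have fH := pol_mem nK bH pf; have gH := pol_mem nK bH pg.
    rewrite Ulin // Uf Ug; apply/funext => z.
    by rewrite -[(a *: f + g) z]/(a *: f z + g z) mulmxDr scalemxAr.
  - rewrite Um; last exact: (pol_mem nK bH).
    by rewrite Uf; apply/funext => z; rewrite /mult_coord scalemxAr.
(* Tested against a polynomial p, both the preimage of K'(., w)v and the claimed kernel function
   give <A p(w), v>. *)
have pre w v : U (kfun K w (adjmx A *m v)) = kfun K' w v.
  have [h hh Uh] := Usurj _ (mem_kfun H' w v); rewrite -Uh; congr U.
  have hk := mem_kfun H w (adjmx A *m v).
  apply/esym/eqP; rewrite -subr_eq0; apply/eqP/(pol_total hK nK bH); first exact: memB.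
  move=> p pp; have pm := pol_mem nK bH pp.
  rewrite ip_conj //; last exact: memB.
  rewrite ipBr // reproducing // -Uip // Uh reproducing; last exact: UH.
  by rewrite Upol // cinner_mulmxl subrr rmorph0.
(* The formula U f = A f extends from polynomials to all members by pairing U f with K'(., z)v,
   whose preimage is now known. *)
have Uall f z : Defs.mem H f -> U f z = A *m f z.
  move=> hf; apply: cinner_inj => v; rewrite cinner_mulmxl -(reproducing _ _ hf).
  by rewrite -(reproducing z v (UH _ hf)) -pre Uip //; exact: mem_kfun.
exists A => // z w; apply: mulmx_cV_inj => v.
rewrite -[LHS]/(kfun K' w v z) -pre Uall; last exact: mem_kfun.
by rewrite /kfun !mulmxA.
Qed.

(** Conjugation by a fixed matrix commutes with the averages and with their limits. *)
Lemma component_conjugate (A : 'M[C]_d) :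
  (forall z w, K' z w = A *m K z w *m adjmx A) ->
  forall l z w, k' l (val z) (val w) = A *m k l (val z) (val w) *m adjmx A.
Proof.
move=> hA l z w; have [om prim_om] := unity_roots R.
apply: (mtends_unique (component_avg_cvg prim_om hK' l z w)).
have := mtends_mulmxr (adjmx A) (mtends_mulmx A (component_avg_cvg prim_om hK l z w)).
rewrite /mtends => h i j; have := h i j; congr tends; apply/funext => n.
congr (fun_of_matrix _ i j); rewrite /component_avg -scalemxAr -scalemxAl.
rewrite mulmx_sumr mulmx_suml; congr (_ *: _); apply: eq_bigr => t _.
by rewrite hA -scalemxAr -scalemxAl.
Qed.

Lemma kernel_eq_of_components : (forall l z w, k l (val z) (val w) = k' l (val z) (val w)) ->
  K = K'.
Proof.
move=> h; apply/funext => z; apply/funext => w.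
apply: (mtends_unique (hom_cvg hK z w)) => i j; have := hom_cvg hK' z w i j.
by congr tends; apply/funext => n; rewrite !summxE; apply: eq_bigr => l _; rewrite h.
Qed.

End ConjugateKernel.

(** * Kernels of the two forms *)

Section Forms.
Variables (R : realType) (d : nat).
Local Notation C := R[i].
Local Notation Bd := (Ball R d).
Local Notation F := (Bd -> 'cV[C]_d).
Implicit Types (P : 'cV[C]_d -> 'cV[C]_d -> 'M[C]_d) (x y z w v : 'cV[C]_d).

Lemma polZ (a : C) (f : F) : pol f -> pol (a *: f).
Proof. by move=> pf; rewrite -[X in pol X]addr0; apply: polDZ => //; exact: (pol_const 0). Qed.

Lemma polD (f g : F) : pol f -> pol g -> pol (f + g).
Proof. by move=> pf; rewrite -[X in pol (X + _)]scale1r; exact: polDZ. Qed.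

Lemma pol_sum (I : Type) (r : seq I) (G : I -> F) :
  (forall i, pol (G i)) -> pol (\sum_(i <- r) G i).
Proof.
move=> h; elim: r => [|i r IH]; first by rewrite big_nil; exact: (pol_const 0).
by rewrite big_cons; exact: polD.
Qed.

Lemma pol_cinnerX w l (f : F) : pol f -> pol (fun z : Bd => cinner (val z) w ^+ l *: f z).
Proof.
move=> pf; elim: l => [|l IH].
  by rewrite (_ : (fun _ => _) = f) //; apply/funext => z; rewrite expr0 scale1r.
rewrite (_ : (fun _ => _) =
  \sum_i (w i 0)^* *: mult_coord i (fun z : Bd => cinner (val z) w ^+ l *: f z)).
  by apply: pol_sum => i; apply/polZ/pol_mult.
apply/funext => z; rewrite fct_sumE exprS -scalerA {1}/cinner scaler_suml.
apply: eq_bigr => i _.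
by rewrite [RHS]/(_ *: (_ *: _)) [RHS]scalerA mulrC.
Qed.

(* The [w] of [form_diag] is the conjugate of [x] for the first form and [x] for the second. *)
Record rank_one_form P : Prop := {
  formZl : forall (a : C) z w, P (a *: z) w = a *: P z w;
  formZr : forall (a : C) z w, P z (a *: w) = a^* *: P z w;
  form_pol : forall w v, pol (fun z : Bd => P (val z) w *m v);
  form_diag : forall x, in_ball x -> exists w : Bd,
    P (val w) (val w) = z_wbardag x x /\ cinner (val w) (val w) = cinner x x }.

Lemma rank_one_sharp : rank_one_form (@wbar_zdag R d).
Proof.
split=> [a z w|a z w|w v|x hx].
- by apply/matrixP => i j; rewrite !mxE; ring.
- by apply/matrixP => i j; rewrite !mxE rmorphM /=; ring.
- rewrite (_ : (fun _ => _) =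
    \sum_j v j 0 *: mult_coord j (fun=> \col_i (w i 0)^*)).
    by apply: pol_sum => j; apply/polZ/pol_mult/pol_const.
  apply/funext => z; rewrite fct_sumE; apply/matrixP => i j; rewrite ord1 mxE summxE.
  by apply: eq_bigr => t _; rewrite !mxE; ring.
- have e : cinner (\col_i (x i 0)^*) (\col_i (x i 0)^*) = cinner x x.
    by apply: eq_bigr => i _; rewrite mxE conjCK mulrC.
  have hw : in_ball (\col_i (x i 0)^*) by rewrite /in_ball e.
  exists (exist (@in_ball R d) _ hw); split=> //=.
  by apply/matrixP => i j; rewrite !mxE conjCK.
Qed.

Lemma rank_one_sharpsharp : rank_one_form (@z_wbardag R d).
Proof.
split=> [a z w|a z w|w v|x hx].
- by apply/matrixP => i j; rewrite !mxE; ring.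
- by apply/matrixP => i j; rewrite !mxE rmorphM /=; ring.
- rewrite (_ : (fun _ => _) =
    (* The matrix applied to v is <v, w> z. *)
    \sum_i mult_coord i (fun=> cinner v w *: delta_mx i 0)).
    by apply: pol_sum => j; apply/pol_mult/pol_const.
  apply/funext => z; rewrite fct_sumE; apply/matrixP => i j; rewrite ord1 mxE summxE.
  rewrite [RHS](bigD1 i) //= [X in _ = _ + X]big1 => [|t ti].
    rewrite !mxE !eqxx mulr1 addr0 /cinner mulr_sumr.
    by apply: eq_bigr => t _; rewrite mxE; ring.
  by rewrite !mxE eq_sym (negPf ti) !mulr0.
- by exists (exist (@in_ball R d) _ hx).
Qed.

(** The term of the first series with index l has exponent l - 1, and its rank one matrix supplies
    the missing degree; in degree 0 only the identity term occurs. *)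
Definition form_component P (a1 a2 : nat -> C) l z w : 'M[C]_d :=
  (if l is l'.+1 then ((a1 l - a2 l) * cinner z w ^+ l') *: P z w else 0) +
  (a2 l * cinner z w ^+ l) *: 1%:M.

Lemma mx_cvg_mtends (S : nat -> 'M[C]_d) L : mx_cvg S L -> mtends S L.
Proof.
move=> h i j e e0; have [|N hN] := h i j e%:C; first by rewrite ltcR.
by exists N => n /hN; rewrite norm_normcE ltcR.
Qed.

Lemma form_expansion P K a1 a2 : rank_one_form P -> kernel_form P K a1 a2 ->
  hom_expansion K (form_component P a1 a2).
Proof.
move=> hP hK; split.
- move=> z w i j; have [X [Y [/mx_cvg_mtends hX [/mx_cvg_mtends hY ->]]]] := hK z w.
  have := tendsD (hX i j) (hY i j) => h; rewrite mxE => e /h [N hN].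
  (* The n-th partial sums of the two series run up to l = n included, that is over l < n + 1,
     whence the shift. *)
  exists N.+1 => -[//|n] /hN; congr (normc (_ - _) < e).
  rewrite /form_component big_split mxE /=; congr (fun_of_matrix _ i j + fun_of_matrix _ i j).
    by rewrite [RHS]big_ord_recl add0r big_add1 /= big_mkord.
  by rewrite big_mkord.
- move=> l a z w; rewrite /form_component (formZl hP) -[w in cinner (a *: z) w]scale1r cinnerZ rmorph1 mulr1.
  case: l => [|l]; first by rewrite !expr0 !add0r scale1r.
  by rewrite scalerDr !scalerA !exprMn !exprS; congr (_ *: _ + _ *: _); ring.
- move=> l a z w; rewrite /form_component (formZr hP) -[z in cinner z (a *: w)]scale1r cinnerZ mul1r.
  case: l => [|l]; first by rewrite !expr0 !add0r scale1r.
  by rewrite scalerDr !scalerA !exprMn !exprS; congr (_ *: _ + _ *: _); ring.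
- move=> l w v; have p1 := polZ (a2 l) (pol_cinnerX w l (pol_const v)).
  case: l p1 => [|l] p1.
    rewrite (_ : (fun _ => _) = a2 0%N *: (fun z : Bd => cinner (val z) w ^+ 0 *: v)) //.
    apply/funext => z; rewrite /form_component add0r -scalemxAl mul1mx -scalerA.
    by [].
  have p2 := polZ (a1 l.+1 - a2 l.+1) (pol_cinnerX w l (form_pol hP w v)).
  rewrite (_ : (fun _ => _) =
    (a1 l.+1 - a2 l.+1) *: (fun z : Bd => cinner (val z) w ^+ l *: (P (val z) w *m v)) +
    a2 l.+1 *: (fun z : Bd => cinner (val z) w ^+ l.+1 *: v)).
    exact: polD.
  apply/funext => z; rewrite /form_component mulmxDl -!scalemxAl mul1mx -!scalerA.
  by [].
Qed.

(** * Comparison of coefficients at an eigenvector *)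

Lemma cinner_eq0 x : cinner x x = 0 -> x = 0.
Proof.
move=> /eqP; rewrite psumr_eq0 => [/allP h|i _]; last by rewrite mul_conj ler0c sqr_ge0.
apply/matrixP => i j; rewrite ord1 mxE; have := h i (mem_index_enum i).
by rewrite /= mul_conjC_eq0 => /eqP.
Qed.

(** If A x = a x with A unitary, then |a| = 1, so conjugation multiplies the rank one matrix of x by
    |a|^2 = 1. *)
Lemma unitary_eigenvector (A : 'M[C]_d) : (0 < d)%N -> adjmx A *m A = 1%:M ->
  exists x, [/\ x != 0, in_ball x & A *m z_wbardag x x *m adjmx A = z_wbardag x x].
Proof.
(* Library eigenvectors are row vectors, hence the transpose. *)
move=> d0 AA; have [a /eigenvalueP [v va v0]] := eigenvalue_closed A^T d0.
have [t t0 ht] : exists2 t : C, t != 0 & in_ball (t *: v^T).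
  have := cinner_ge0 v^T; case e : (cinner _ _) => [q y]; rewrite lecE /= => /andP[/eqP y0 q0].
  have q1 : 0 < 1 + q by lra.
  (* Scaling by 1 / (1 + q) turns the squared norm q into q / (1 + q)^2 < 1. *)
  exists (1 + q)^-1%:C; first by rewrite fmorph_eq0 invr_eq0 gt_eqF.
  have {}e : cinner v^T v^T = q%:C by rewrite e y0.
  rewrite /in_ball cinnerZ conj_real e -!rmorphM -[X in _ < X]/(1%:C) ltcR.
  rewrite -invfM mulrC ltr_pdivrMr; nra.
exists (t *: v^T); split=> //; first by rewrite scaler_eq0 negb_or t0 trmx_eq0.
set x := t *: v^T.
have Ax : A *m x = a *: x.
  by rewrite -scalemxAr -[A]trmxK -trmx_mul va linearZ /= scalerA mulrC -scalerA.
have xN0 : cinner x x != 0.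
  by apply/negP => /eqP/cinner_eq0/eqP; rewrite scaler_eq0 trmx_eq0 (negPf t0) (negPf v0).
move: x ht Ax xN0 => x _ Ax xN0.
have aa : a * a^* = 1.
  apply: (mulIf xN0); rewrite -cinnerZ -Ax mul1r cinner_mulmxl mulmxA AA mul1mx //.
pose xs : 'rV[C]_d := \row_j (x j 0)^*.
have xsA : xs *m adjmx A = a^* *: xs.
  apply/matrixP => i j; rewrite ord1; have /matrixP/(_ j 0) /(congr1 Num.conj) := Ax.
  rewrite !mxE rmorph_sum rmorphM /= => <-; apply: eq_bigr => s _.
  by rewrite !mxE rmorphM /= mulrC.
have -> : z_wbardag x x = x *m xs.
  by apply/matrixP => i j; rewrite !mxE big_ord1 !mxE.
by rewrite mulmxA Ax -mulmxA xsA -scalemxAl -scalemxAr scalerA aa scale1r.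
Qed.

Lemma rank_one_scalar_indep x (al be al' be' : C) : (1 < d)%N -> x != 0 ->
  al *: z_wbardag x x + be *: 1%:M = al' *: z_wbardag x x + be' *: 1%:M ->
  al = al' /\ be = be'.
Proof.
move=> d1 x0 /matrixP e.
have [i xi] : exists i, x i 0 != 0.
  apply/existsP; apply: contraNT x0 => /existsPn h; apply/eqP/matrixP => i j.
  by rewrite ord1 mxE; apply/eqP; rewrite -[_ == _]negbK; exact: h.
have [j ji] : exists j : 'I_d, j != i.
  have [i0|i0] := eqVneq (i : nat) 0%N.
    by exists (Ordinal d1); rewrite -val_eqE /= i0.
  by exists (Ordinal (ltnW d1)); rewrite -val_eqE /= eq_sym.
have := e i j; have := e i i; have := e j j; rewrite !mxE !eqxx eq_sym (negPf ji) !mulr0 !addr0 !mulr1.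
(* If x_j = 0, the (j, j) entry isolates the scalar coefficient; otherwise the (i, j) entry isolates
   the rank one coefficient. *)
have [xj|xj] := eqVneq (x j 0) 0.
  rewrite xj mul0r !mulr0 !add0r => -> /addIr /mulIf h _; split=> //.
  by apply: h; rewrite mul_conjC_eq0.
by move=> + _ /mulIf h; rewrite h => [/addrI|]; [|rewrite mulf_neq0 ?conjC_eq0].
Qed.

(** At the diagonal point attached to an eigenvector x, conjugation by A fixes both the rank one and
    the identity term. Their independence for d >= 2 and the cancellation of powers of <x, x> equate
    the coefficients, hence the components everywhere. *)
Lemma form_component_conjugate P a1 a2 b1 b2 (A : 'M[C]_d) : (1 < d)%N -> rank_one_form P ->
  adjmx A *m A = 1%:M ->
  (forall l (z w : Bd), form_component P b1 b2 l (val z) (val w) =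
     A *m form_component P a1 a2 l (val z) (val w) *m adjmx A) ->
  forall l z w, form_component P a1 a2 l z w = form_component P b1 b2 l z w.
Proof.
move=> d1 hP AA h l z w.
have [x [x0 bx Ax]] := unitary_eigenvector (ltnW d1) AA.
have [u [Pu cu]] := form_diag hP bx; have := h l u u; rewrite /form_component Pu cu.
have s0 : cinner x x != 0 by apply: contra x0 => /eqP/cinner_eq0 ->.
rewrite mulmxDr mulmxDl -[A *m (_ *: 1%:M)]scalemxAr mulmx1 -[_ *: A *m _]scalemxAl (mulmx1C AA).
case: l => [|l].
  rewrite mulmx0 mul0mx !add0r !expr0 !mulr1 => /matrixP/(_ (Ordinal d1) (Ordinal d1)).
  by rewrite !mxE eqxx !mulr1 => ->.
rewrite -scalemxAr -scalemxAl Ax => /(rank_one_scalar_indep d1 x0) [].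
move=> /mulIf e1 /mulIf e2.
by rewrite e1 ?e2 ?expf_neq0.
Qed.

Lemma form_rigidity P K K' a1 a2 b1 b2 (H : RKHS K) (H' : RKHS K') : rank_one_form P ->
  kernel_form P K a1 a2 -> kernel_form P K' b1 b2 ->
  normalized_kernel K -> normalized_kernel K' -> bounded_mult H -> bounded_mult H' ->
  unitarily_equivalent H H' -> K = K'.
Proof.
move=> hP fK fK' nK nK' bH bH' eq.
have hK := form_expansion hP fK; have hK' := form_expansion hP fK'.
have [A AA hA] := unitary_conjugate_kernel hK nK hK' nK' bH bH' eq.
have [d1|d1] := ltnP 1 d.
  apply: (kernel_eq_of_components hK hK') => l z w.
  by apply: (form_component_conjugate d1 hP AA) => m x y; exact: (component_conjugate hK hK').
(* For d <= 1 the rank one and identity terms are both scalar and coefficients cannot be separated,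
   but all matrices commute, so conjugation by a unitary matrix is trivial. *)
apply/funext => z; apply/funext => w; rewrite hA.
suff -> : A *m K z w = K z w *m A by rewrite -mulmxA (mulmx1C AA) mulmx1.
apply/matrixP => i j; rewrite !mxE.
have sub (s t : 'I_d) : s = t.
  apply/val_inj; have := ltn_ord s; have := ltn_ord t => /=; lia.
by apply: eq_bigr => s _; rewrite (sub i s) (sub j s) mulrC.
Qed.

End Forms.

Theorem theorem4p5 (R : realType) (d : nat)
    (K K' : Ball R d -> Ball R d -> 'M[R[i]]_d)
    (H : RKHS K) (H' : RKHS K') :
  nnd_kernel K -> nnd_kernel K' ->
  normalized_kernel K -> normalized_kernel K' ->
  ((exists a1 a2 b1 b2, form_sharp K a1 a2 /\ form_sharp K' b1 b2) \/
   (exists a1 a2 b1 b2, form_sharpsharp K a1 a2 /\ form_sharpsharp K' b1 b2)) ->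
  bounded_mult H -> bounded_mult H' ->
  (unitarily_equivalent H H' <-> K = K').
Proof.
move=> _ _ nK nK' forms bH bH'; split=> [eq|KK'].
  case: forms => -[a1 [a2 [b1 [b2 [fK fK']]]]].
    exact: (form_rigidity (rank_one_sharp R d) fK fK' nK nK' bH bH' eq).
  exact: (form_rigidity (rank_one_sharpsharp R d) fK fK' nK nK' bH bH' eq).
by subst K'; exact: unitarily_equivalent_same_kernel.
Qed.
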